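(* Let $k\ge0$ and let $\gamma=\{\gamma_{ij}\}_{0\le i+j\le 2k+2}$ be complex numbers with $\overline{\gamma_{ij}}=\gamma_{ji}$ and $\gamma_{00}>0$. Suppose that the columns of the moment matrix $M(k+1)(\gamma)$ satisfy a relation $Z^{k+1}=\sum_{0\le n+m\le k}a_{nm}\bar Z^nZ^m$ with $a_{nm}\in\mathbb{C}$. Let $\widetilde\gamma=\{\widetilde\gamma_{ij}\}_{i,j\ge0}$ be the recursive doubly indexed sequence (RDIS) with initial conditions $\{\gamma_{ij}\}_{0\le i\le j\le k}$ and characteristic polynomial $p(z,\bar z)=z^{k+1}-\sum_{0\le n+m\le k}a_{nm}\bar z^nz^m$. Then $\gamma$ admits a representing measure if and only if $M(2k)(\widetilde\gamma)$ is positive semidefinite.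
   Context: For a (finite or infinite) family $\gamma$, $M(n)(\gamma)$ is the matrix with rows and columns indexed by the monomials $\bar z^iz^j$, $i+j\le n$, whose entry in row $\bar z^{k'}z^{l}$, column $\bar z^iz^j$ is $\gamma_{i+l,j+k'}$; its column indexed by $\bar z^iz^j$ is denoted $\bar Z^iZ^j$. A representing measure for $\gamma=\{\gamma_{ij}\}_{0\le i+j\le2k+2}$ is a positive Borel measure $\mu$ on $\mathbb{C}$ with $\gamma_{ij}=\int\bar z^iz^j\,d\mu$ for all $i+j\le 2k+2$. The RDIS with initial conditions $\{\gamma_{ij}\}_{0\le i\le j\le k}$ and characteristic polynomial $p(z,\bar z)=z^{k+1}-\sum_{0\le n+m\le k}a_{nm}\bar z^nz^m$ is the (unique) sequence $\{\widetilde\gamma_{ij}\}_{i,j\ge0}$ with $\widetilde\gamma_{ij}=\gamma_{ij}$ for $0\le i\le j\le k$, $\widetilde\gamma_{ji}=\overline{\widetilde\gamma_{ij}}$, and $\widetilde\gamma_{i,j+k+1}=\sum_{0\le n+m\le k}a_{nm}\widetilde\gamma_{i+n,j+m}$ for all $i,j\ge0$. *)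

(* Defs.v *)
(* MathComp-Analysis; the complex numbers are R[i] for R : realType. *)
From HB Require Import structures.
From mathcomp Require Import all_boot all_order all_algebra.
From mathcomp Require Import complex spectral zify.
From mathcomp Require Import all_classical all_reals all_analysis.

Set Implicit Arguments.
Unset Strict Implicit.
Unset Printing Implicit Defensive.

Import Order.TTheory GRing.Theory Num.Theory.
Import numFieldNormedType.Exports.

Local Open Scope ring_scope.
Local Open Scope sesquilinear_scope.

(* The pair (i, j) stands for the monomial zbar^i z^j, of degree i + j <= n. *)
Definition monomial (n : nat) : Type :=
  {p : 'I_n.+1 * 'I_n.+1 | (p.1 + p.2 <= n)%N}.

HB.instance Definition _ (n : nat) := Finite.on (monomial n).

Definition zbar_exp (n : nat) (m : monomial n) : nat := (val m).1.
Definition z_exp (n : nat) (m : monomial n) : nat := (val m).2.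

Definition monomial1 (n : nat) : monomial n :=
  exist _ (ord0, ord0) (leq0n n).

(* Only meaningful for i + j <= n; otherwise a default monomial. *)
Definition Mon (n i j : nat) : monomial n :=
  insubd (monomial1 n) (inord i, inord j).

Lemma zbar_exp_Mon (n i j : nat) : (i + j <= n)%N -> zbar_exp (Mon n i j) = i.
Proof.
move=> ijn; have [lt_i lt_j] : (i < n.+1)%N /\ (j < n.+1)%N by split; lia.
by rewrite /zbar_exp /Mon val_insubd /= !inordK // ijn /= inordK.
Qed.

Lemma z_exp_Mon (n i j : nat) : (i + j <= n)%N -> z_exp (Mon n i j) = j.
Proof.
move=> ijn; have [lt_i lt_j] : (i < n.+1)%N /\ (j < n.+1)%N by split; lia.
by rewrite /z_exp /Mon val_insubd /= !inordK // ijn /= inordK.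
Qed.

(* Doubly indexed families, finite or not, are total functions
   nat -> nat -> R[i]: moment_mx n g only reads g i j for i + j <= 2n.
   The rows and columns are numbered by the enumeration of monomial n. *)
Definition moment_mx (R : realType) (n : nat) (g : nat -> nat -> R[i]) :
    'M[R[i]]_#|{: monomial n}| :=
  \matrix_(r, c)
    let row := enum_val r in let col := enum_val c in
    g (zbar_exp col + z_exp row)%N (z_exp col + zbar_exp row)%N.

Definition moment_col (R : realType) (n : nat) (g : nat -> nat -> R[i])
    (i j : nat) : 'cV[R[i]]_#|{: monomial n}| :=
  col (enum_rank (Mon n i j)) (moment_mx n g).

(* On R[i], 0 <= x says that x is real and nonnegative. *)
Definition psdmx (R : realType) (n : nat) (A : 'M[R[i]]_n) : Prop :=
  forall v : 'cV[R[i]]_n, 0 <= ((v ^t*) *m A *m v) 0 0.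

(* R[i]^o carries the topology of the complex modulus. *)
Definition borelC (R : realType) := g_sigma_algebraType (@open R[i]^o).

Definition integrableC (R : realType) (mu : {measure set (borelC R) -> \bar R})
    (f : R[i] -> R[i]) : Prop :=
  mu.-integrable setT (fun z : borelC R => (complex.Re (f z))%:E) /\
  mu.-integrable setT (fun z : borelC R => (complex.Im (f z))%:E).

Definition integralC (R : realType) (mu : {measure set (borelC R) -> \bar R})
    (f : R[i] -> R[i]) : R[i] :=
  Complex (\int[mu]_z complex.Re (f z)) (\int[mu]_z complex.Im (f z)).

(* mu represents the family { g i j : i + j <= N }. *)
Definition representing_measure (R : realType) (N : nat)
    (g : nat -> nat -> R[i]) (mu : {measure set (borelC R) -> \bar R}) : Prop :=
  forall i j : nat, (i + j <= N)%N ->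
    integrableC mu (fun z => z^* ^+ i * z ^+ j) /\
    g i j = integralC mu (fun z => z^* ^+ i * z ^+ j).

(* gt is the RDIS with initial conditions { g i j : 0 <= i <= j <= k } and
   characteristic polynomial
   z^(k+1) - \sum_(0 <= n + m <= k) a n m zbar^n z^m. *)
Definition is_RDIS (R : realType) (k : nat) (g a gt : nat -> nat -> R[i]) :
    Prop :=
  [/\ forall i j : nat, (i <= j <= k)%N -> gt i j = g i j,
      forall i j : nat, gt j i = (gt i j)^* &
      forall i j : nat, gt i (j + k.+1)%N =
        \sum_(m : monomial k) a (zbar_exp m) (z_exp m) *
          gt (i + zbar_exp m)%N (j + z_exp m)%N].

Lemma exp_leq (k : nat) (m : monomial k) : (zbar_exp m + z_exp m <= k)%N.
Proof. exact: (valP m). Qed.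

Lemma RDIS_unique (R : realType) (k : nat) (g a gt gt' : nat -> nat -> R[i]) :
  is_RDIS k g a gt -> is_RDIS k g a gt' -> forall i j, gt i j = gt' i j.
Proof.
move=> [init herm rec] [init' herm' rec'] i j.
have [d le_d] := ubnP (i + j)%N; elim: d => // d IHd in i j le_d *.
wlog le_ij : i j le_d / (i <= j)%N => [IH|].
  have [/IH->//|/ltnW lt_ji] := leqP i j.
  by rewrite herm herm' IH // addnC.
have [le_jk|lt_kj] := leqP j k; first by rewrite init ?init' ?le_ij.
rewrite -(subnK lt_kj) rec rec'; apply: eq_bigr => m _.
by have := exp_leq m => le_m; rewrite IHd //; lia.
Qed.

Lemma RDIS_exists (R : realType) (k : nat) (g a : nat -> nat -> R[i]) :
  (forall i, (i <= k)%N -> (g i i)^* = g i i) -> exists gt, is_RDIS k g a gt.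
Proof.
move=> g_real.
pose S (f : nat -> nat -> R[i]) i j := \sum_(m : monomial k)
  a (zbar_exp m) (z_exp m) * f (i + zbar_exp m)%N (j + z_exp m)%N.
pose B f i j := if (j <= k)%N then
    if (i <= k)%N then if (i <= j)%N then g i j else (g j i)^*
    else (S f j (i - k.+1)%N)^*
  else S f i (j - k.+1)%N.
have eqB f f' i j :
    (forall i' j', (i' + j' < i + j)%N -> f i' j' = f' i' j') ->
  B f i j = B f' i j.
  move=> eqf; rewrite /B /S.
  case: (leqP j k) => [le_jk|lt_kj]; last first.
    by apply: eq_bigr => m _; rewrite eqf //; have := exp_leq m; lia.
  case: (leqP i k) => // lt_ki; congr (_^*).
  by apply: eq_bigr => m _; rewrite eqf //; have := exp_leq m; lia.
pose F d := iter d B (fun _ _ => 0).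
have Fd d d' i j : (i + j < d)%N -> (i + j < d')%N -> F d i j = F d' i j.
  elim: d d' i j => // d IHd [|d'] // i j lt_d lt_d' /=.
  by apply: eqB => i' j' lt_ij; apply: IHd; lia.
pose gt i j := F (i + j).+1 i j.
have gtE i j : gt i j = B gt i j.
  by apply: eqB => i' j' lt_ij; apply: Fd; lia.
have recE i j : gt i (j + k.+1)%N = S gt i j.
  by rewrite gtE /B addnK leqNgt ifN // negbK; lia.
have herm i j : gt j i = (gt i j)^*.
  have [d le_d] := ubnP (i + j)%N; elim: d => // d IHd in i j le_d *.
  case: (leqP j k) => [le_jk|lt_kj]; case: (leqP i k) => [le_ik|lt_ki].
  - rewrite !gtE /B le_ik le_jk; case: ltngtP => [||->]; rewrite ?conjCK //.
    by rewrite g_real.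
  - by rewrite !gtE /B leqNgt lt_ki le_jk /= conjCK.
  - by rewrite !gtE /B [(j <= k)%N]leqNgt lt_kj le_ik.
  rewrite -(subnK lt_ki) -(subnK lt_kj) !recE /S.
  set i' := (i - k.+1)%N; set j' := (j - k.+1)%N.
  have ->: \sum_(m : monomial k) a (zbar_exp m) (z_exp m) *
      gt (j' + k.+1 + zbar_exp m)%N (i' + z_exp m)%N =
    \sum_(m : monomial k) \sum_(p : monomial k) a (zbar_exp m) (z_exp m) *
      (a (zbar_exp p) (z_exp p))^* *
      gt (j' + zbar_exp m + z_exp p)%N (i' + z_exp m + zbar_exp p)%N.
    apply: eq_bigr => m _; have le_m := exp_leq m.
    rewrite (IHd (i' + z_exp m)%N); last by rewrite /i'; lia.
    rewrite (_ : (j' + k.+1 + zbar_exp m = j' + zbar_exp m + k.+1)%N); last lia.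
    rewrite recE /S rmorph_sum mulr_sumr; apply: eq_bigr => p _.
    have le_p := exp_leq p.
    rewrite rmorphM /= mulrA -IHd; last by rewrite /i' /j'; lia.
    by [].
  rewrite exchange_big rmorph_sum /=; apply: eq_bigr => p _.
  have le_p := exp_leq p; rewrite rmorphM /= -IHd; last by rewrite /i' /j'; lia.
  rewrite (_ : (i' + k.+1 + zbar_exp p = i' + zbar_exp p + k.+1)%N); last lia.
  rewrite recE /S mulr_sumr; apply: eq_bigr => m _.
  rewrite mulrCA mulrA; congr (_ * gt _ _); lia.
exists gt; split=> // i j /andP[le_ij le_jk].
by rewrite gtE /B le_jk (leq_trans le_ij le_jk) le_ij.
Qed.

(* Main.v *)
(** If mu represents gamma, the column relation says that p vanishes mu-almost
    everywhere, so almost everywhere a monomial divisible by z^(k+1) or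
    zbar^(k+1) is a combination of monomials of smaller degree; hence all the
    moments of mu exist and they are the RDIS, and the quadratic form of its
    moment matrix at v is the integral of |f|^2 for a polynomial f.
    Conversely the same recursion reduces every polynomial, modulo p and its
    conjugate, to degree at most 2k. Multiplication by z and by zbar therefore
    act on the polynomials of degree at most 2k, where M(2k) is a semi-inner
    product for which they are adjoint to each other and commute. Modulo its
    kernel, multiplication by z is a normal operator; its eigenvalues are the
    atoms of a finitely atomic measure, and the squared moduli of the coordinates
    of the polynomial 1 in an eigenbasis are their masses. *)

Require Import Defs.
From HB Require Import structures.
From mathcomp Require Import all_boot all_order all_algebra.
From mathcomp Require Import complex spectral zify ring lra.
From mathcomp Require Import all_classical all_reals all_analysis.
From mathcomp Require Import measurable_realfun.

Set Implicit Arguments.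
Unset Strict Implicit.
Unset Printing Implicit Defensive.

Import Order.TTheory GRing.Theory Num.Theory.
Import numFieldNormedType.Exports.

Local Open Scope ring_scope.

(** * Integration against finitely atomic measures *)

Lemma exists_atomic_measure d (T : measurableType d) (R : realType)
    (s : seq ({nonneg R} * T)) :
  exists mu : {measure set T -> \bar R}, forall f : T -> \bar R,
    measurable_fun setT f -> (forall x, 0 <= f x)%E ->
    (\int[mu]_x f x = \sum_(p <- s) p.1%:num%:E * f p.2)%E.
Proof.
elim: s => [|p s [mu muE]].
  by exists mzero => f mf f0; rewrite big_nil integral_measure_zero.
exists (measure_add (mscale p.1 (dirac p.2)) mu) => f mf f0.
rewrite ge0_integral_measure_add//= muE// big_cons ge0_integral_mscale//.
by rewrite integral_dirac// diracT mul1e.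
Qed.

(** The integral of [|f|] is a finite sum of reals, hence finite; the value then comes from the
    positive and negative parts of [f]. *)
Lemma exists_atomic_integral d (T : measurableType d) (R : realType)
    (s : seq ({nonneg R} * T)) :
  exists mu : {measure set T -> \bar R}, forall f : T -> R,
    measurable_fun setT f ->
    mu.-integrable setT (EFin \o f) /\
    \int[mu]_x f x = \sum_(p <- s) p.1%:num * f p.2.
Proof.
have [mu muE] := exists_atomic_measure s; exists mu => f mf.
have mf' : measurable_fun setT (EFin \o f) by exact/measurable_EFinP.
have finsum (g : T -> R) :
    (\sum_(p <- s) p.1%:num%:E * (g p.2)%:E = (\sum_(p <- s) p.1%:num * g p.2)%:E)%E.
  by rewrite -sumEFin.
split.
  apply/integrableP; split => //.
  rewrite muE//; last exact: measurableT_comp.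
  by rewrite (finsum (fun x => `|f x|)) ltry.
rewrite /Rintegral integralE !muE//; last 2 first.
- exact: measurable_funeneg.
- exact: measurable_funepos.
have posE x : ((EFin \o f)^\+ x = (Num.max (f x) 0)%:E)%E by rewrite funeposE EFin_max.
have negE x : ((EFin \o f)^\- x = (Num.max (- f x) 0)%:E)%E.
  by rewrite funenegE EFin_max.
under eq_bigr do rewrite posE.
under [X in (_ - X)%E]eq_bigr do rewrite negE.
rewrite (finsum (fun x => Num.max (f x) 0)) (finsum (fun x => Num.max (- f x) 0)).
rewrite /= -sumrB; apply: eq_bigr => p _.
rewrite -mulrBr; congr (_ * _).
by have [|] := leP (f p.2) 0 => ?; have [|] := leP (- f p.2) 0 => ?; lra.
Qed.

(** * Borel measurability on the complex plane *)

Lemma le_Im_norm (R : realType) (z : R[i]) : `|complex.Im z|%:C%C <= `|z|.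
Proof.
have := normc_ge_Re (z * Complex 0 1).
rewrite ReiNIm normrN normrM [X in _ * X]normc_def /=.
by rewrite expr0n expr1n add0r sqrtr1 mulr1.
Qed.

(** Preimages of open rays []r, +oo[] are open: around a point [z] with [r < f z], the ball of
    radius [f z - r] stays inside. *)
Lemma contraction_measurable (R : realType) (f : R[i] -> R) :
  (forall z w, `|f z - f w|%:C%C <= `|z - w|) ->
  measurable_fun setT (f : borelC R -> R).
Proof.
move=> fc; apply: (measurability _ (RGenOInfty.measurableE R)) => //.
move=> _ [_ [r ->] <-]; rewrite setTI; apply: sub_sigma_algebra.
rewrite openE => z /=; rewrite in_itv/= andbT => rz.
apply/nbhs_ballP; exists (f z - r)%:C%C => /=.
  by rewrite ltcR subr_gt0.
move=> w; rewrite -ball_normE /= => zw.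
rewrite in_itv/= andbT.
have := le_lt_trans (fc z w) zw; rewrite ltcR => h.
have := ler_norm (f z - f w); lra.
Qed.

Definition measurableC (R : realType) (f : R[i] -> R[i]) : Prop :=
  measurable_fun setT (fun z : borelC R => complex.Re (f z)) /\
  measurable_fun setT (fun z : borelC R => complex.Im (f z)).

Section MeasurableC.
Variable R : realType.
Implicit Types (f g : R[i] -> R[i]) (z w : R[i]).

Lemma ReD z w : complex.Re (z + w) = complex.Re z + complex.Re w.
Proof. by case: z; case: w. Qed.

Lemma ImD z w : complex.Im (z + w) = complex.Im z + complex.Im w.
Proof. by case: z; case: w. Qed.

Lemma ReM z w : complex.Re (z * w) =
  complex.Re z * complex.Re w - complex.Im z * complex.Im w.
Proof. by case: z; case: w. Qed.

Lemma ImM z w : complex.Im (z * w) =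
  complex.Re z * complex.Im w + complex.Im z * complex.Re w.
Proof. by case: z => a b; case: w => c d /=; ring. Qed.

Lemma ReJ z : complex.Re z^* = complex.Re z.
Proof. by case: z. Qed.

Lemma ImJ z : complex.Im z^* = - complex.Im z.
Proof. by case: z. Qed.

Lemma measurableC_cst (c : R[i]) : measurableC (fun=> c).
Proof. by split; exact: measurable_cst. Qed.

Lemma measurableC_id : measurableC (@id R[i]).
Proof.
split; apply: contraction_measurable => z w.
  by rewrite -(raddfB (@complex.Re R)); exact: normc_ge_Re.
by rewrite -(raddfB (@complex.Im R)); exact: le_Im_norm.
Qed.

Lemma measurableC_conj f : measurableC f -> measurableC (fun z => (f z)^*).
Proof.
move=> [mr mi]; split.
  by under eq_fun do rewrite ReJ.
by under eq_fun do rewrite ImJ; exact: measurableT_comp.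
Qed.

Lemma measurableC_mul f g : measurableC f -> measurableC g ->
  measurableC (fun z => f z * g z).
Proof.
move=> [fr fi] [gr gi]; split.
  under eq_fun do rewrite ReM.
  by apply: measurable_funB; exact: measurable_funM.
under eq_fun do rewrite ImM.
by apply: measurable_funD; exact: measurable_funM.
Qed.

Lemma measurableC_exp f n : measurableC f -> measurableC (fun z => f z ^+ n).
Proof.
move=> mf; elim: n => [|n IHn]; first exact: measurableC_cst.
by under eq_fun do rewrite exprS; exact: measurableC_mul.
Qed.

Lemma measurableC_monomial i j : measurableC (fun z => z^* ^+ i * z ^+ j).
Proof.
apply: measurableC_mul; apply: measurableC_exp; last exact: measurableC_id.
exact: measurableC_conj measurableC_id.
Qed.

End MeasurableC.

(** * Calculus of complex-valued integrals, taken coordinatewise *)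

Section IntegralC.
Variables (R : realType) (mu : {measure set (borelC R) -> \bar R}).
Implicit Types f g : R[i] -> R[i].

Lemma integrableC_measurable f : integrableC mu f -> measurableC f.
Proof.
by case=> /measurable_int /measurable_EFinP fr /measurable_int /measurable_EFinP.
Qed.

Lemma integralC_add f g : integrableC mu f -> integrableC mu g ->
  integrableC mu (fun z => f z + g z) /\
  integralC mu (fun z => f z + g z) = integralC mu f + integralC mu g.
Proof.
move=> [fr fi] [gr gi].
have eR : (fun z => complex.Re (f z + g z)) =
    (fun z => complex.Re (f z) + complex.Re (g z)) by apply: funext => z; rewrite ReD.
have eI : (fun z => complex.Im (f z + g z)) =
    (fun z => complex.Im (f z) + complex.Im (g z)) by apply: funext => z; rewrite ImD.
split; first split.
- rewrite (_ : (fun _ => _) = (fun z => (complex.Re (f z))%:E + (complex.Re (g z))%:E)%E).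
    exact: integrableD.
  by apply: funext => z; rewrite ReD.
- rewrite (_ : (fun _ => _) = (fun z => (complex.Im (f z))%:E + (complex.Im (g z))%:E)%E).
    exact: integrableD.
  by apply: funext => z; rewrite ImD.
- by rewrite /integralC eR eI !RintegralD.
Qed.

Lemma integralC_scale (c : R[i]) f : integrableC mu f ->
  integrableC mu (fun z => c * f z) /\
  integralC mu (fun z => c * f z) = c * integralC mu f.
Proof.
move=> [fr fi].
have iZ (r : R) (h : borelC R -> R) : mu.-integrable setT (EFin \o h) ->
    mu.-integrable setT (EFin \o (fun z => r * h z)).
  by move=> /(integrableZl measurableT r).
have eR : (fun z => complex.Re (c * f z)) =
    (fun z => complex.Re c * complex.Re (f z) - complex.Im c * complex.Im (f z)).
  by apply: funext => z; rewrite ReM.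
have eI : (fun z => complex.Im (c * f z)) =
    (fun z => complex.Re c * complex.Im (f z) + complex.Im c * complex.Re (f z)).
  by apply: funext => z; rewrite ImM.
split; first split.
- rewrite (_ : (fun _ => _) = EFin \o (fun z => complex.Re (c * f z)))// eR.
  exact: (integrableB measurableT (iZ _ _ fr) (iZ _ _ fi)).
- rewrite (_ : (fun _ => _) = EFin \o (fun z => complex.Im (c * f z)))// eI.
  exact: (integrableD measurableT (iZ _ _ fi) (iZ _ _ fr)).
- rewrite /integralC eR eI RintegralB ?RintegralD ?RintegralZl//; try exact: iZ.
  by case: (c).
Qed.

Lemma integralC_sum (I : Type) (s : seq I) (c : I -> R[i])
    (F : I -> R[i] -> R[i]) : (forall i, integrableC mu (F i)) ->
  integrableC mu (fun z => \sum_(i <- s) c i * F i z) /\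
  integralC mu (fun z => \sum_(i <- s) c i * F i z) =
    \sum_(i <- s) c i * integralC mu (F i).
Proof.
move=> iF; elim: s => [|i s [IHi IHe]].
  under [X in integrableC _ X]eq_fun do rewrite big_nil.
  under [X in integralC _ X]eq_fun do rewrite big_nil.
  rewrite big_nil; split; first by split; exact: integrable0.
  by rewrite /integralC /Rintegral integral0.
under [X in integrableC _ X]eq_fun do rewrite big_cons.
under [X in integralC _ X]eq_fun do rewrite big_cons.
have [sci sce] := integralC_scale (c i) (iF i).
have [adi ade] := integralC_add sci IHi.
by split => //; rewrite big_cons ade sce IHe.
Qed.

Lemma integralC_conj f : integrableC mu f ->
  integrableC mu (fun z => (f z)^*) /\
  integralC mu (fun z => (f z)^*) = (integralC mu f)^*.
Proof.
move=> [fr fi].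
have eR : (fun z => complex.Re (f z)^*) = (fun z => complex.Re (f z)).
  by apply: funext => z; rewrite ReJ.
have eI : (fun z => complex.Im (f z)^*) = (fun z => (-1) * complex.Im (f z)).
  by apply: funext => z; rewrite ImJ mulN1r.
split; first split.
- by under eq_fun do rewrite ReJ.
- by under eq_fun do rewrite ImJ -mulN1r EFinM; exact: integrableZl.
- by rewrite /integralC eR eI RintegralZl// mulN1r.
Qed.

Lemma ae_weaken (P Q : borelC R -> Prop) : (forall z, P z -> Q z) ->
  {ae mu, forall z, P z} -> {ae mu, forall z, Q z}.
Proof. by move=> PQ; apply: (@filterS _ _ (ae_filter_ringOfSetsType mu)). Qed.

(** As [mu] need not be complete, measurability of [g] is assumed rather than inherited from [f]. *)
Lemma ae_integralC f g : {ae mu, forall z, f z = g z} -> measurableC g ->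
  integrableC mu f -> integrableC mu g /\ integralC mu f = integralC mu g.
Proof.
move=> fg [gr gi] iF; have [fr fi] := integrableC_measurable iF.
have real_ae (u v : borelC R -> R) : {ae mu, forall z, u z = v z} ->
    measurable_fun setT u -> measurable_fun setT v ->
    mu.-integrable setT (fun z => (u z)%:E) ->
    mu.-integrable setT (fun z => (v z)%:E) /\ \int[mu]_z u z = \int[mu]_z v z.
  move=> uv mu' mv /integrableP[mU Ufin].
  have mV : measurable_fun setT (fun z => (v z)%:E) by exact/measurable_EFinP.
  split; last first.
    congr fine; apply: ae_eq_integral => //.
    by apply: ae_weaken uv => z /= -> _.
  apply/integrableP; split=> //.
  rewrite -(@ae_eq_integral _ _ _ mu setT (fun z => `|(v z)%:E|)%E (fun z => `|(u z)%:E|)%E)//.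
  - exact: measurableT_comp.
  - exact: measurableT_comp.
  - by apply: ae_weaken uv => z /= -> _.
have [||||ir er] := real_ae (fun z => complex.Re (f z)) (fun z => complex.Re (g z)) => //.
- by apply: ae_weaken fg => z ->.
- by case: iF.
have [||||ii ei] := real_ae (fun z => complex.Im (f z)) (fun z => complex.Im (g z)) => //.
- by apply: ae_weaken fg => z ->.
- by case: iF.
by split => //; rewrite /integralC er ei.
Qed.

Lemma integralC_normsq_ge0 f : 0 <= integralC mu (fun z => (f z)^* * f z).
Proof.
rewrite lecE /=; apply/andP; split.
  rewrite /Rintegral; under eq_integral do rewrite ImM ReJ ImJ mulNr mulrC subrr.
  by rewrite integral0.
apply: Rintegral_ge0 => z _; rewrite ReM ReJ ImJ mulNr opprK.
by rewrite addr_ge0// -expr2 sqr_ge0.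
Qed.

(** The integrand is the nonnegative real function [Re^2 + Im^2], so a zero integral forces both
    squares to vanish almost everywhere. *)
Lemma integralC_normsq_eq0 f : integrableC mu (fun z => (f z)^* * f z) ->
  integralC mu (fun z => (f z)^* * f z) = 0 -> {ae mu, forall z, f z = 0}.
Proof.
move=> [ir _] /(congr1 (@complex.Re R)) /= i0.
have nE z : complex.Re ((f z)^* * f z) = complex.Re (f z) ^+ 2 + complex.Im (f z) ^+ 2.
  by rewrite ReM ReJ ImJ mulNr opprK !expr2.
have n0 z : 0 <= complex.Re ((f z)^* * f z) by rewrite nE addr_ge0 ?sqr_ge0.
have := ae_eq_integral_abs mu measurableT (measurable_int _ ir).
under eq_integral do rewrite gee0_abs ?lee_fin//.
(* Integrability makes the extended integral finite, so it is determined by its real value, which is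
   0. *)
rewrite -[X in X = 0%E <-> _]fineK ?integrable_fin_num// -/(Rintegral _ _ _) i0.
case=> /(_ erefl) h _; apply: ae_weaken h => z /(_ I) /= [].
move=> /eqP; rewrite nE paddr_eq0 ?sqr_ge0// !sqrf_eq0 => /andP[/eqP r0 /eqP i0'].
by apply/eqP; rewrite eq_complex r0 i0' !eqxx.
Qed.

End IntegralC.

(** * Hermitian square roots and diagonalization of normal matrices *)

Section NormalCompression.
Local Open Scope sesquilinear_scope.
Variables (C : numClosedFieldType) (n : nat).
Implicit Types (A B G U W : 'M[C]_n) (d : 'rV[C]_n).

Lemma trmxC_mul m p q (A : 'M[C]_(m, p)) (B : 'M[C]_(p, q)) :
  (A *m B)^t* = B^t* *m A^t*.
Proof. by rewrite trmx_mul map_mxM. Qed.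

Lemma trmxC_diag d : (diag_mx d)^t* = diag_mx (map_mx Num.conj d).
Proof. by rewrite tr_diag_mx map_diag_mx. Qed.

(** Functional calculus on the spectral decomposition of [G]: [U] is its square root and [W] the
    pseudo-inverse of [U]. *)
Lemma psd_sqrt_pinv G : G^t* = G ->
  (forall v : 'cV[C]_n, 0 <= (v^t* *m G *m v) 0 0) ->
  exists U W, [/\ U^t* = U, W^t* = W, U *m U = G, W *m U = U *m W &
                  U *m W *m U = U].
Proof.
move=> Gherm Gpsd.
have /orthomx_spectralP : G \is normalmx by apply/normalmxP; rewrite Gherm.
set P := spectralmx G; set s := spectral_diag G.
have Pu : P \is unitarymx := spectral_unitarymx G.
rewrite invmx_unitary// => GE.
have PP : P *m P^t* = 1%:M := unitarymxP Pu.
have s_ge0 l : 0 <= s 0 l.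
  (* The eigenvalue [s 0 l] is the value of the form at the unit eigenvector
     [P^t* *m delta_mx l 0]. *)
  have := Gpsd (P^t* *m delta_mx l 0).
  rewrite trmxC_mul trmxCK {1}GE !mulmxA.
  rewrite -[_ *m P *m P^t*]mulmxA PP mulmx1 -[_ *m P *m P^t*]mulmxA PP mulmx1.
  rewrite trmx_delta map_delta_mx -rowE -colE row_diag_mx.
  by rewrite !mxE !eqxx mulr1.
pose D (f : C -> C) := P^t* *m diag_mx (map_mx f s) *m P.
have DM f g : D f *m D g = D (fun x => f x * g x).
  rewrite /D !mulmxA -[_ *m P *m P^t*]mulmxA PP mulmx1 -[_ *m diag_mx _ *m diag_mx _]mulmxA.
  by rewrite mulmx_diag; congr (_ *m diag_mx _ *m _); apply/rowP => l; rewrite !mxE.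
have Dherm f : (forall x, 0 <= x -> f x \is Num.real) -> (D f)^t* = D f.
  move=> fr; rewrite /D !trmxC_mul trmxCK trmxC_diag mulmxA.
  congr (_ *m diag_mx _ *m _); apply/rowP => l; rewrite !mxE.
  exact/CrealP/fr/s_ge0.
have eqD f g : (forall x, 0 <= x -> f x = g x) -> D f = D g.
  by move=> fg; congr (_ *m diag_mx _ *m _); apply/rowP => l; rewrite !mxE fg.
(* Since [0^-1 = 0], the function defining [W] vanishes on the kernel of [G], as a pseudo-inverse
   must. *)
exists (D sqrtC), (D (fun x => (sqrtC x)^-1)); split.
- by apply: Dherm => x x0; rewrite ger0_real// sqrtC_ge0.
- by apply: Dherm => x x0; rewrite ger0_real// invr_ge0 sqrtC_ge0.
- rewrite DM [RHS]GE (eqD _ id) => [|x _]; last by rewrite -expr2 sqrtCK.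
  by congr (_ *m diag_mx _ *m _); apply/rowP => l; rewrite !mxE.
- by rewrite !DM; apply: eqD => x _; rewrite mulrC.
- rewrite !DM; apply: eqD => x _.
  by have [->|x0] := eqVneq (sqrtC x) 0; rewrite ?mul0r ?mulr0// mulfV// mul1r.
Qed.

(* [A] and [B] are the compressions of multiplication by [z] and [zbar]; after
   conjugation by the square root [U] of the Gram matrix and its pseudo-inverse
   [W] they become adjoint to each other, hence normal because they commute. *)
Lemma normal_compression G A B : G^t* = G ->
  (forall v : 'cV[C]_n, 0 <= (v^t* *m G *m v) 0 0) ->
  G *m A = B^t* *m G -> G *m A *m B = G *m B *m A ->
  exists U T, [/\ U^t* = U, T \is normalmx, U *m U = G,
                  T *m U = U *m A & T^t* *m U = U *m B].
Proof.
move=> Gherm Gpsd GA GAB.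
have GB : G *m B = A^t* *m G.
  rewrite -[G in LHS]Gherm -[B]trmxCK. by rewrite -trmxC_mul -GA trmxC_mul Gherm.
have [U [W [Uh Wh UU WU UWU]]] := psd_sqrt_pinv Gherm Gpsd.
have UUW : U *m U *m W = U by rewrite -mulmxA -WU mulmxA UWU.
have WG : W *m G = U by rewrite -UU mulmxA WU UWU.
(* As [U = W *m G], the hypothesis turns [U *m X] into a left multiple of [G], and
   [G *m W *m U = G]. *)
have intertwine X Y : G *m X = Y *m G -> U *m X *m W *m U = U *m X.
  move=> GX; have -> : U *m X = W *m Y *m G by rewrite -mulmxA -GX mulmxA WG.
  by rewrite -!mulmxA; congr (W *m (Y *m _)); rewrite -UU !mulmxA UUW.
exists U, (U *m A *m W).
have Tadj : (U *m A *m W)^t* = U *m B *m W.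
  rewrite !trmxC_mul Uh Wh -{1}UUW UU 2!mulmxA.
  by rewrite -[W *m _ *m G]mulmxA -GB !mulmxA WG.
have TU := intertwine _ _ GA; have TU' := intertwine _ _ GB.
split=> //; last by rewrite Tadj.
(* The two products reduce to [U *m A *m B *m W] and [U *m B *m A *m W]; writing [U] as [W *m G]
   brings in the commutation hypothesis. *)
apply/normalmxP; rewrite Tadj !mulmxA TU TU'; congr (_ *m W).
by rewrite -WG -!mulmxA; congr (W *m _); rewrite !mulmxA.
Qed.

(** The iterates are [G *m A^j *m B^i]. Diagonalizing the normal compression [T] turns [A] into
    multiplication by the eigenvalues and [B] into multiplication by their conjugates. *)
Lemma spectral_moments G A B (e : 'cV[C]_n) : G^t* = G ->
  (forall v : 'cV[C]_n, 0 <= (v^t* *m G *m v) 0 0) ->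
  G *m A = B^t* *m G -> G *m A *m B = G *m B *m A ->
  exists x d : 'I_n -> C, forall i j,
    (e^t* *m iter i (mulmxr B) (iter j (mulmxr A) G) *m e) 0 0 =
    \sum_l (x l)^* * x l * ((d l)^* ^+ i * d l ^+ j).
Proof.
move=> Gherm Gpsd GA GAB.
have [U [T [Uh Tn UU TU TU']]] := normal_compression Gherm Gpsd GA GAB.
move: Tn => /orthomx_spectralP; set P := spectralmx T; set d := spectral_diag T.
have Pu : P \is unitarymx := spectral_unitarymx T.
rewrite invmx_unitary// => TE.
have PP : P *m P^t* = 1%:M := unitarymxP Pu.
have TE' : T^t* = P^t* *m diag_mx (map_mx Num.conj d) *m P.
  by rewrite {1}TE !trmxC_mul trmxCK trmxC_diag mulmxA.
(* [D f] is [U *m f(T) *m U]; right multiplication by [X] passes through [U], becomes [T] or its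
   adjoint, and multiplies [f] by [z] or its conjugate. *)
pose D (f : C -> C) := U *m P^t* *m diag_mx (map_mx f d) *m P *m U.
have step S X f g : S *m U = U *m X -> S = P^t* *m diag_mx (map_mx g d) *m P ->
    D f *m X = D (fun z => f z * g z).
  move=> SU SE; rewrite /D -mulmxA -SU SE !mulmxA.
  rewrite -[_ *m P *m P^t*]mulmxA PP mulmx1 -[_ *m diag_mx _ *m diag_mx _]mulmxA.
  by rewrite mulmx_diag; congr (_ *m diag_mx _ *m _ *m _); apply/rowP => l; rewrite !mxE.
have PP' : P^t* *m P = 1%:M by exact: mulmx1C.
have GE i j : iter i (mulmxr B) (iter j (mulmxr A) G) = D (fun z => z ^+ j * z^* ^+ i).
  elim: i => [|i IHi] /=; last first.
    rewrite IHi (step _ _ _ Num.conj TU' TE').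
    by congr D; apply: funext => z; rewrite exprSr mulrA.
  elim: j => [|j IHj] /=.
    rewrite /D (_ : diag_mx _ = 1%:M) ?mulmx1 -?[_ *m _ *m P]mulmxA ?PP' ?mulmx1//.
    by apply/matrixP => p q; rewrite !mxE !expr0 mulr1.
  rewrite IHj (step _ _ _ id TU).
    by congr D; apply: funext => z; rewrite exprSr !expr0 !mulr1.
  by rewrite {1}TE; congr (_ *m diag_mx _ *m _); apply/rowP => l; rewrite !mxE.
(* The coordinates of [U *m e] in the eigenbasis of [T]. *)
pose y := P *m U *m e; exists (fun l => y l 0), (d 0) => i j.
rewrite GE; have -> : e^t* *m D (fun z => z ^+ j * z^* ^+ i) *m e =
    y^t* *m diag_mx (map_mx (fun z => z ^+ j * z^* ^+ i) d) *m y.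
  by rewrite /y /D !trmxC_mul Uh !mulmxA.
clearbody y; rewrite mxE; apply: eq_bigr => l _; rewrite mul_mx_diag !mxE.
by rewrite mulrAC [_ ^+ j * _]mulrC.
Qed.

End NormalCompression.

(** * Atomic measures on the complex plane *)

Lemma sqmod_ge0 (R : realType) (x : R[i]) : 0 <= complex.Re (x^* * x).
Proof. by rewrite ReM ReJ ImJ mulNr opprK -!expr2 addr_ge0 ?sqr_ge0. Qed.

(** The masses are the reals [|x l|^2], so real and imaginary parts integrate separately. The points
    [d l] may coincide; their masses then add up. *)
Lemma exists_atomic_integralC (R : realType) (n : nat) (x d : 'I_n -> R[i]) :
  exists mu : {measure set (borelC R) -> \bar R}, forall f, measurableC f ->
    integrableC mu f /\ integralC mu f = \sum_l (x l)^* * x l * f (d l).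
Proof.
pose s := [seq (NngNum (sqmod_ge0 (x l)), d l : borelC R) | l <- index_enum 'I_n].
have [mu muE] := exists_atomic_integral s; exists mu => f [fr fi].
have [ir er] := muE _ fr; have [ii ei] := muE _ fi.
split=> //; rewrite /integralC er ei !big_map.
apply/eqP; rewrite eq_complex (raddf_sum (@complex.Re R)) (raddf_sum (@complex.Im R)).
have Im0 l : complex.Im ((x l)^* * x l) = 0 by rewrite ImM ReJ ImJ mulNr mulrC subrr.
apply/andP; split; apply/eqP; apply: eq_bigr => l _.
  by rewrite [RHS]ReM Im0 mul0r subr0.
by rewrite [RHS]ImM Im0 mul0r addr0.
Qed.

(** * The moment matrix as a quadratic form on polynomials *)

Section MomentForm.
Local Open Scope sesquilinear_scope.
Variables (R : realType) (n : nat) (g : nat -> nat -> R[i]).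
Implicit Type v : 'cV[R[i]]_#|{: monomial n}|.

Definition poly_of v (z : R[i]) : R[i] :=
  \sum_c v c 0 * (z^* ^+ zbar_exp (enum_val c) * z ^+ z_exp (enum_val c)).

Lemma moment_form v : (v^t* *m moment_mx n g *m v) 0 0 =
  \sum_(p : 'I_#|{: monomial n}| * 'I_#|{: monomial n}|)
    (v p.1 0)^* * v p.2 0 *
    g (zbar_exp (enum_val p.2) + z_exp (enum_val p.1))%N
      (z_exp (enum_val p.2) + zbar_exp (enum_val p.1))%N.
Proof.
rewrite -(pair_bigA _ (fun r c => (v r 0)^* * v c 0 *
   g (zbar_exp (enum_val c) + z_exp (enum_val r))%N
      (z_exp (enum_val c) + zbar_exp (enum_val r))%N)) /=.
rewrite mxE exchange_big; apply: eq_bigr => c _ /=.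
rewrite mxE mulr_suml; apply: eq_bigr => r _.
by rewrite !mxE mulrAC.
Qed.

(** Conjugation exchanges the exponents of the row monomial, which gives exactly the crossed indices
    of [moment_mx]; integrating term by term then yields [moment_form]. *)
Lemma poly_of_normsq v z : (poly_of v z)^* * poly_of v z =
  \sum_(p : 'I_#|{: monomial n}| * 'I_#|{: monomial n}|)
    (v p.1 0)^* * v p.2 0 *
    (z^* ^+ (zbar_exp (enum_val p.2) + z_exp (enum_val p.1)) *
     z ^+ (z_exp (enum_val p.2) + zbar_exp (enum_val p.1))).
Proof.
rewrite /poly_of rmorph_sum /= big_distrlr /= pair_bigA /=.
apply: eq_bigr => p _; rewrite rmorphM mulrACA; congr (_ * _).
rewrite rmorphM !rmorphXn /= conjCK mulrC.
by rewrite [z ^+ _ * _]mulrC mulrACA -!exprD.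
Qed.

Lemma moment_form_integral (mu : {measure set (borelC R) -> \bar R}) v :
  representing_measure (2 * n) g mu ->
  integrableC mu (fun z => (poly_of v z)^* * poly_of v z) /\
  (v^t* *m moment_mx n g *m v) 0 0 =
    integralC mu (fun z => (poly_of v z)^* * poly_of v z).
Proof.
move=> rep; rewrite moment_form (funext (poly_of_normsq v)).
pose F (p : 'I_#|{: monomial n}| * 'I_#|{: monomial n}|) (z : R[i]) :=
  z^* ^+ (zbar_exp (enum_val p.2) + z_exp (enum_val p.1)) *
  z ^+ (z_exp (enum_val p.2) + zbar_exp (enum_val p.1)).
have repF p : integrableC mu (F p) /\
    g (zbar_exp (enum_val p.2) + z_exp (enum_val p.1))%N
      (z_exp (enum_val p.2) + zbar_exp (enum_val p.1))%N = integralC mu (F p).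
  apply: rep; have := exp_leq (enum_val p.1); have := exp_leq (enum_val p.2); lia.
have [si se] := integralC_sum (index_enum _) (fun p => (v p.1 0)^* * v p.2 0)
  (fun p => (repF p).1).
split; first exact: si.
by rewrite se; apply: eq_bigr => p _; rewrite (repF p).2.
Qed.

End MomentForm.

(** * The RDIS, its moments, and reduction of monomials *)

Definition swap_monomial n (m : monomial n) : monomial n :=
  Mon n (z_exp m) (zbar_exp m).

Lemma swap_monomialK n : involutive (@swap_monomial n).
Proof.
move=> m; have le_m := exp_leq m.
have swapE : (z_exp m + zbar_exp m <= n)%N by rewrite addnC.
rewrite /swap_monomial zbar_exp_Mon// z_exp_Mon//.
apply: val_inj; rewrite /Mon val_insubd.
case: m le_m {swapE} => -[i j] /= ij _; rewrite /zbar_exp /z_exp /= !inord_val.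
by rewrite ij.
Qed.

Section RDIS.
Local Open Scope sesquilinear_scope.
Variables (R : realType) (k : nat) (gamma a gammat : nat -> nat -> R[i]).
Hypothesis gamma_herm : forall i j : nat, (i + j <= 2 * k + 2)%N ->
  (gamma i j)^* = gamma j i.
Hypothesis col_rel : moment_col k.+1 gamma 0 k.+1 =
  \sum_(m : monomial k) a (zbar_exp m) (z_exp m) *:
    moment_col k.+1 gamma (zbar_exp m) (z_exp m).
Hypothesis gammat_RDIS : is_RDIS k gamma a gammat.

(** The row is [zbar^t z^s], with crossed exponents, so that [s] adds to [i] and [t] to [j]. *)
Lemma moment_colE i j s t : (i + j <= k.+1)%N -> (s + t <= k.+1)%N ->
  moment_col k.+1 gamma i j (enum_rank (Mon k.+1 t s)) 0 = gamma (i + s)%N (j + t)%N.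
Proof.
move=> ij st; have ts : (t + s <= k.+1)%N by rewrite addnC.
by rewrite !mxE /= !enum_rankK !zbar_exp_Mon ?z_exp_Mon.
Qed.

(** For [i <= j] and [k < j], the column relation read in row [zbar^(j-k-1) z^i] is the recursion at
    [(i, j)]. This row exists because [i + j <= 2k + 2]. *)
Lemma RDIS_extends i j : (i + j <= 2 * k + 2)%N -> gammat i j = gamma i j.
Proof.
have [init herm rec] := gammat_RDIS.
have [d le_d] := ubnP (i + j)%N; elim: d => // d IHd in i j le_d *.
wlog le_ij : i j le_d / (i <= j)%N => [IH|] ij2k.
  have [/IH->//|/ltnW lt_ji] := leqP i j.
  by rewrite herm IH// 1?addnC// gamma_herm// addnC.
have [le_jk|lt_kj] := leqP j k; first by rewrite init ?le_ij.
have /matrixP/(_ (enum_rank (Mon k.+1 (j - k.+1) i)) 0) := col_rel.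
have st : (i + (j - k.+1) <= k.+1)%N by lia.
rewrite moment_colE// summxE subnKC// add0n => ->.
rewrite -{1}(subnK lt_kj) rec; apply: eq_bigr => m _; have := exp_leq m => le_m.
rewrite mxE moment_colE//; last by lia.
by rewrite IHd ?[(i + _)%N]addnC ?[(_ - _ + _)%N]addnC//; lia.
Qed.

(** The coefficient vector [v] of [p] lies in the kernel of the moment matrix, so the integral of
    [|p|^2] is 0. *)
Lemma representing_ae_recursion (mu : {measure set (borelC R) -> \bar R}) :
  representing_measure (2 * k + 2) gamma mu ->
  {ae mu, forall z, z ^+ k.+1 =
    \sum_(m : monomial k) a (zbar_exp m) (z_exp m) * (z^* ^+ zbar_exp m * z ^+ z_exp m)}.
Proof.
move=> rep.
pose e i j : 'cV[R[i]]_#|{: monomial k.+1}| :=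
  delta_mx (enum_rank (Mon k.+1 i j)) 0.
pose v := e 0%N k.+1 -
  \sum_(m : monomial k) a (zbar_exp m) (z_exp m) *: e (zbar_exp m) (z_exp m).
have Mv0 : moment_mx k.+1 gamma *m v = 0.
  rewrite mulmxBr mulmx_sumr -colE -/(moment_col _ _ _ _) col_rel.
  apply/eqP; rewrite subr_eq0; apply/eqP; apply: eq_bigr => m _.
  by rewrite -scalemxAr -colE.
have rep' : representing_measure (2 * k.+1) gamma mu by rewrite mulnSr.
have [vi ve] := moment_form_integral v rep'.
have poly_e i j z : (i + j <= k.+1)%N -> poly_of (e i j) z = z^* ^+ i * z ^+ j.
  move=> ij; rewrite /poly_of (bigD1 (enum_rank (Mon k.+1 i j)))//=.
  rewrite enum_rankK mxE !eqxx mul1r zbar_exp_Mon// z_exp_Mon// big1 ?addr0// => c ne.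
  by rewrite mxE (negbTE ne) mul0r.
have poly_sub u w z : poly_of (u - w : 'cV_#|{: monomial k.+1}|) z =
    poly_of u z - poly_of w z :> R[i].
  by rewrite /poly_of -sumrB; apply: eq_bigr => l _; rewrite !mxE mulrBl.
have poly_v z : poly_of v z = z ^+ k.+1 -
    \sum_(m : monomial k) a (zbar_exp m) (z_exp m) * (z^* ^+ zbar_exp m * z ^+ z_exp m).
  rewrite poly_sub poly_e// mul1r; congr (_ - _).
  transitivity (\sum_(m : monomial k) a (zbar_exp m) (z_exp m) *
      poly_of (e (zbar_exp m) (z_exp m)) z).
    rewrite {1}/poly_of; under eq_bigr do rewrite summxE mulr_suml.
    rewrite exchange_big; apply: eq_bigr => m _; rewrite mulr_sumr.
    by apply: eq_bigr => l _; rewrite mxE -mulrA.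
  by apply: eq_bigr => m _; rewrite poly_e// ltnW// ltnS exp_leq.
have := integralC_normsq_eq0 vi; rewrite -ve -mulmxA Mv0 mulmx0 mxE => /(_ erefl).
by apply: ae_weaken => z /eqP; rewrite poly_v subr_eq0 => /eqP.
Qed.

(** Induction on the degree: multiplying the almost everywhere relation by [zbar^i z^(j-k-1)]
    expresses a monomial by integrable ones of lower degree, which gives both its integrability and
    the recursion. *)
Lemma representing_RDIS (mu : {measure set (borelC R) -> \bar R}) :
  representing_measure (2 * k + 2) gamma mu ->
  forall N, representing_measure N gammat mu.
Proof.
move=> rep N i j _.
have [init herm rec] := gammat_RDIS.
have aez := representing_ae_recursion rep.
have [d le_d] := ubnP (i + j)%N; elim: d => // d IHd in i j le_d *.
wlog le_ij : i j le_d / (i <= j)%N => [IH|].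
  have [/IH|/ltnW lt_ji] := leqP i j.
    exact.
  have [|//|ji je] := IH j i; first by rewrite addnC.
  have [ci ce] := integralC_conj ji.
  rewrite herm je -ce (_ : (fun z => z^* ^+ i * z ^+ j) = (fun z => (z^* ^+ j * z ^+ i)^*))//.
  by apply: funext => z; rewrite rmorphM !rmorphXn /= conjCK mulrC.
have [le_jk|lt_kj] := leqP j k; first by rewrite RDIS_extends; [apply: rep|]; lia.
rewrite -(subnK lt_kj); set j' := (j - k.+1)%N.
have IH (m : monomial k) :
    integrableC mu (fun z => z^* ^+ (i + zbar_exp m) * z ^+ (j' + z_exp m)) /\
    gammat (i + zbar_exp m)%N (j' + z_exp m)%N =
    integralC mu (fun z => z^* ^+ (i + zbar_exp m) * z ^+ (j' + z_exp m)).
  by apply: IHd; have := exp_leq m; rewrite /j'; lia.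
have [si se] := integralC_sum (index_enum _) (fun m => a (zbar_exp m) (z_exp m))
  (fun m => (IH m).1).
have [|ii ie] := ae_integralC _ (measurableC_monomial R i (j' + k.+1)) si.
  apply: ae_weaken aez => z ze; rewrite exprD ze mulrA mulr_sumr.
  by apply: eq_bigr => m _; rewrite [RHS]mulrCA !exprD [in RHS]mulrACA.
split=> //; rewrite -ie se rec; apply: eq_bigr => m _; by rewrite (IH m).2.
Qed.

(** The coefficients [c] are chosen before [s] and [t]: they reduce the monomial [zbar^i z^j] itself
    modulo [p] and its conjugate, compatibly with every further shift. *)
Lemma RDIS_reduction i j : exists c : monomial (2 * k) -> R[i], forall s t,
  gammat (i + s)%N (j + t)%N =
    \sum_m c m * gammat (zbar_exp m + s)%N (z_exp m + t)%N.
Proof.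
have [init herm rec] := gammat_RDIS.
have [d le_d] := ubnP (i + j)%N; elim: d => // d IHd in i j le_d *.
wlog le_ij : i j le_d / (i <= j)%N => [IH|].
  have [/IH|/ltnW lt_ji] := leqP i j.
    exact.
  have [|//|c cE] := IH j i; first by rewrite addnC.
  (* Conjugating the reduction of [zbar^j z^i] swaps the exponents of each monomial. *)
  exists (fun m => (c (swap_monomial m))^*) => s t.
  rewrite herm cE rmorph_sum /= (reindex_inj (inv_inj (@swap_monomialK _))).
  apply: eq_bigr => m _; rewrite rmorphM /= -herm.
  by rewrite /swap_monomial zbar_exp_Mon ?z_exp_Mon// addnC exp_leq.
have [le_jk|lt_kj] := leqP j k.
  (* Here [i <= j <= k], so the monomial already has degree at most [2k]; this is where the bound
     [2k] arises. *)
  exists (fun m => (m == Mon (2 * k) i j)%:R) => s t.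
  have ij : (i + j <= 2 * k)%N by lia.
  rewrite (bigD1 (Mon (2 * k) i j))//= eqxx mul1r zbar_exp_Mon// z_exp_Mon//.
  by rewrite big1 ?addr0// => m /negbTE ->; rewrite mul0r.
have /choice[c cE] : forall m : monomial k, exists c : monomial (2 * k) -> R[i], forall s t,
    gammat (i + zbar_exp m + s)%N (j - k.+1 + z_exp m + t)%N =
    \sum_m c m * gammat (zbar_exp m + s)%N (z_exp m + t)%N.
  by move=> m; apply: IHd; have := exp_leq m; lia.
exists (fun p => \sum_(m : monomial k) a (zbar_exp m) (z_exp m) * c m p) => s t.
under [RHS]eq_bigr do rewrite mulr_suml; rewrite exchange_big /=.
rewrite (_ : (j + t = j - k.+1 + t + k.+1)%N); last by lia.
rewrite rec; apply: eq_bigr => m _.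
rewrite addnAC [(_ + t + _)%N]addnAC cE mulr_sumr; apply: eq_bigr => p _.
by rewrite mulrA.
Qed.

Lemma psd_RDIS_representing : psdmx (moment_mx (2 * k) gammat) ->
  exists mu : {measure set (borelC R) -> \bar R},
    representing_measure (2 * k + 2) gamma mu.
Proof.
move=> psd; have [_ herm _] := gammat_RDIS.
set n := #|{: monomial (2 * k)}|; set G := moment_mx (2 * k) gammat.
(* The matrix of the form weighted by [zbar^p z^q]. *)
pose S p q : 'M[R[i]]_n := moment_mx (2 * k) (fun i j => gammat (i + p)%N (j + q)%N).
have S_herm p q : (S p q)^t* = S q p.
  by apply/matrixP => r c; rewrite !mxE -herm; congr gammat; lia.
(* [A] is multiplication by [zbar^u z^v] followed by reduction to degree at most [2k]. One [A]
   serves all [p] and [q] since the reduction is uniform in shifts. *)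
have shift u v : exists A : 'M[R[i]]_n, forall p q, S p q *m A = S (u + p)%N (v + q)%N.
  have /choice[c cE] : forall m : monomial (2 * k),
      exists c : monomial (2 * k) -> R[i], forall s t : nat,
      gammat (zbar_exp m + u + s)%N (z_exp m + v + t)%N =
      \sum_(m' : monomial (2 * k)) c m' * gammat (zbar_exp m' + s)%N (z_exp m' + t)%N.
    by move=> m; exact: RDIS_reduction.
  exists (\matrix_(l, m) c (enum_val m) (enum_val l)) => p q.
  apply/matrixP => l m; rewrite !mxE /=.
  rewrite (_ : gammat _ _ = gammat (zbar_exp (enum_val m) + u + (z_exp (enum_val l) + p))%N
     (z_exp (enum_val m) + v + (zbar_exp (enum_val l) + q))%N); last by congr gammat; lia.
  rewrite cE [RHS](reindex _ (onW_bij _ (enum_val_bij _))) /=; apply: eq_bigr => m' _.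
  by rewrite !mxE mulrC /= !addnA.
have GE : G = S 0%N 0%N by apply/matrixP => r c; rewrite !mxE /= !addn0.
have [A AE] := shift 0%N 1%N; have [B BE] := shift 1%N 0%N.
have G_herm : G^t* = G by rewrite GE S_herm.
have GA : G *m A = B^t* *m G.
  by rewrite -[G in RHS]G_herm -trmxC_mul GE BE S_herm AE.
have GAB : G *m A *m B = G *m B *m A by rewrite GE !(AE, BE).
(* The polynomial 1, at which the form of [S i j] takes the value [gammat i j]. *)
pose e : 'cV[R[i]]_n := delta_mx (enum_rank (Mon (2 * k) 0 0)) 0.
have [x [d xdE]] := spectral_moments e G_herm psd GA GAB.
have momentE i j : gammat i j = \sum_l (x l)^* * x l * ((d l)^* ^+ i * d l ^+ j).
  rewrite -xdE; have -> : iter i (mulmxr B) (iter j (mulmxr A) G) = S i j.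
    elim: i => [|i /= ->]; last by rewrite BE.
    by elim: j => [//|j /= ->]; rewrite AE.
  rewrite trmx_delta map_delta_mx -rowE -colE !mxE /= enum_rankK.
  by rewrite zbar_exp_Mon// z_exp_Mon.
have [mu muE] := exists_atomic_integralC x d; exists mu => i j ij.
have [mi me] := muE _ (measurableC_monomial R i j).
by rewrite -RDIS_extends// momentE me.
Qed.

End RDIS.

Theorem theorem21 (R : realType) (k : nat) (gamma : nat -> nat -> R[i])
    (gamma_herm : forall i j : nat, (i + j <= 2 * k + 2)%N ->
       (gamma i j)^* = gamma j i)
    (gamma00_gt0 : 0 < gamma 0%N 0%N)
    (a : nat -> nat -> R[i])
    (col_rel : moment_col k.+1 gamma 0 k.+1 =
       \sum_(m : monomial k) a (zbar_exp m) (z_exp m) *: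
         moment_col k.+1 gamma (zbar_exp m) (z_exp m))
    (gammat : nat -> nat -> R[i])
    (gammat_RDIS : is_RDIS k gamma a gammat) :
  (exists mu : {measure set (borelC R) -> \bar R},
     representing_measure (2 * k + 2) gamma mu) <->
  psdmx (moment_mx (2 * k) gammat).
Proof.
split; last exact: (psd_RDIS_representing gamma_herm col_rel gammat_RDIS).
(* The form of [M(2k)] involves moments up to degree [4k], which can exceed the [2k + 2] given by
   [rep]. *)
move=> [mu rep] v; have rept := representing_RDIS gamma_herm col_rel gammat_RDIS rep.
have [_ ->] := moment_form_integral v (rept _).
exact: integralC_normsq_ge0.
Qed.
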